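(* Suppose that $D_1$ and $D_2$ are link shadow diagrams, and let $D_1\# D_2$ be a connect sum of them. With respect to the Link Smoothing Game: \begin{enumerate} \item If $D_1$ and $D_2$ are both $\mathcal{P}$-position, then $D_1\# D_2$ is $\mathcal{P}$-position. \item If $D_1$ is $\mathcal{P}$-position and $D_2$ is $\mathcal{N}$-position, then $D_1\# D_2$ is $\mathcal{N}$-position. \item If $D_1$ and $D_2$ are both $\mathcal{N}$-position, then $D_1\# D_2$ is $L$-position. \item Any connect sum with an $L$-position summand is $L$-position. \end{enumerate}
   Context: A link shadow $D$ is a connected link diagram in which under/over information is unspecified at the crossings (called precrossings). Link Smoothing Game on $D$: two players, $K$ (Knot) and $L$ (Link), alternately select a remaining precrossing and replace it by either of its two smoothings (horizontal or vertical), until no precrossings remain. $K$ wins if the final diagram is connected; $L$ wins if it is disconnected (once disconnected, the diagram stays disconnected). Graph of a shadow: checkerboard color the regions of $D$; the (black) graph $G$ has one vertex per black region and one edge per precrossing, joining the black regions meeting there (loops and multi-edges allowed). $G$ is a connected plane graph; the white graph is its planar dual $G^*$. Every connected plane graph arises in this way. Smoothing a precrossing amounts to either deleting the corresponding edge of $G$ (and contracting the dual edge in $G^*$) or contracting it in $G$ (and deleting the dual edge in $G^*$). The shadow is connected if and only if both graphs are connected. Thus, on $G$, players alternately choose a remaining edge and delete or contract it; $L$ wins as soon as a cut edge is deleted or a loop is contracted (the latter deletes a cut edge of the dual), and $K$ wins if all edges are used up without this ever happening. Outcome classes: a shadow is in $\mathcal{N}$-position if the first player to move (whichever of $K$, $L$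 that is) can guarantee a win; $\mathcal{P}$-position if the second player to move can guarantee a win; $L$-position if $L$ can guarantee a win whether moving first or second. Connect sum: $D_1\# D_2$ is obtained from the diagrams $D_1$ and $D_2$ by removing a small arc segment from an exterior arc of each diagram and connecting the two diagrams at the newly formed endpoints by a pair of parallel curves. On the level of graphs, if $G_1,G_2$ are the black graphs of $D_1,D_2$, then the black graph of $D_1\# D_2$ is the wedge $G_1\vee G_2$, obtained by identifying an exterior vertex of $G_1$ with an exterior vertex of $G_2$. *)

(* Defs.v *)
From mathcomp Require Import all_boot all_fingroup.

Set Implicit Arguments.
Unset Strict Implicit.
Unset Printing Implicit Defensive.

Import GroupScope.

(* A plane diagram is encoded as a combinatorial map: its vertices are joined
   by arc segments, and a dart is one of the two ends of a segment.
     arc d == the other end of the segment of d;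
     rot d == the next dart, counterclockwise, around the vertex of d;
     ext   == a dart with the exterior region on its right, when the segment
              is travelled away from the vertex of the dart.
   The vertices are the orbits of rot: an orbit of size 4 is a precrossing, an
   orbit of size 2 is an ordinary point of the curve.  The ordinary points are
   what remains of a smoothed precrossing; they also subdivide arcs, so that
   the crossingless circle is represented (two darts, one point).            *)
Record diagram := Diagram {
  dart : finType;
  arc : {perm dart};
  rot : {perm dart};
  ext : dart
}.

(* The boundary of the region on the right of d: follow the segment of d, then
   leave along the next dart counterclockwise.  Regions of a connected diagram
   are the orbits of this permutation ((s * t) x = t (s x) for permutations). *)
Definition face (D : diagram) : {perm dart D} := arc D * rot D.

Definition exterior (D : diagram) (d : dart D) : bool :=
  d \in porbit (face D) (ext D).

Definition adjacent (D : diagram) : rel (dart D) :=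
  [rel x y | (y == arc D x) || (y == rot D x)].

Definition connected (D : diagram) : bool :=
  [forall x, forall y, connect (@adjacent D) x y].

(* The last clause is Euler's formula V + F = E + 2. *)
Definition shadow (D : diagram) : Prop :=
  [/\ forall d : dart D, arc D (arc D d) = d /\ arc D d <> d,
      forall d : dart D, #|porbit (rot D) d| = 2 \/ #|porbit (rot D) d| = 4,
      connected D
    & #|porbits (rot D)| + #|porbits (face D)| = #|porbits (arc D)| + 2].

Definition precrossing (D : diagram) (d : dart D) : bool :=
  #|porbit (rot D) d| == 4.

(* If d, a, b, c are the darts of a precrossing in counterclockwise order, so
   that rot contains the cycle (d a b c), the product below contains
   (d a)(b c) instead: the strands at d and a are joined, and so are those at
   b and c.  Smoothing at b gives the same result, smoothing at a or c gives
   the other smoothing.                                                      *)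
Definition smooth (D : diagram) (d : dart D) : diagram :=
  @Diagram (dart D) (arc D) (rot D * tperm d (rot D (rot D d))) (ext D).

Inductive player := Knot | Link.

Definition opponent (p : player) : player :=
  match p with Knot => Link | Link => Knot end.

Definition winner (D : diagram) : player :=
  if connected D then Knot else Link.

(* can_win p q D: in the game on D with q to move, p can guarantee a win. *)
Inductive can_win (p : player) : player -> diagram -> Prop :=
| WinOver q (D : diagram) of
    (forall d : dart D, ~~ precrossing d) & winner D = p : can_win p q D
| WinOwnMove (D : diagram) (d : dart D) of
    precrossing d & can_win p (opponent p) (smooth d) : can_win p p D
| WinOpponentMove (D : diagram) of
    (exists d : dart D, precrossing d)
  & (forall d : dart D, precrossing d -> can_win p p (smooth d)) :
    can_win p (opponent p) D.

Definition N_position (D : diagram) : Prop := forall p, can_win p p D.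
Definition P_position (D : diagram) : Prop := forall p, can_win p (opponent p) D.
Definition L_position (D : diagram) : Prop := forall q, can_win Link q D.

Section SumPerm.
Variables (S T : finType) (s : {perm S}) (t : {perm T}).

Definition sum_perm_fun (x : S + T) : S + T :=
  match x with inl y => inl (s y) | inr z => inr (t z) end.

Lemma sum_perm_inj : injective sum_perm_fun.
Proof. by case=> [x|x] [y|y] //= [] /perm_inj ->. Qed.

Definition sum_perm : {perm S + T} := perm sum_perm_inj.
End SumPerm.

(* The segments {d1, arc d1} and {d2, arc d2} are cut and replaced by the two
   segments {d1, arc d2} and {d2, arc d1}.  When d1 and d2 are exterior, this
   is the planar connection of the two diagrams, drawn side by side, along two
   parallel curves: a traveller leaving along d1 keeps the exterior region on
   the right, hence arrives at the far end of d2.                            *)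
Definition connect_sum (D1 D2 : diagram) (d1 : dart D1) (d2 : dart D2) :
    diagram :=
  @Diagram (dart D1 + dart D2)%type
    (sum_perm (arc D1) (arc D2) ^ tperm (inl d1) (inr d2))
    (sum_perm (rot D1) (rot D2))
    (inl d1).

(* Main.v *)
Require Import Defs.
From mathcomp Require Import all_boot all_fingroup.
From mathcomp Require Import zify.

(* A connected plane diagram with n precrossings has n + 2 regions, and its
   darts admit a colouring that arc and rot both reverse: the checkerboard
   colouring of the regions.  A smoothing that keeps the diagram connected
   merges two regions of one colour, hence removes one region, and at each
   precrossing the two smoothings act on the two colours.  The imbalance k is
   the difference between the numbers of black and white regions: it has the
   parity of n, is at most n, and changes by one at every move.  Link can
   always increase it (or disconnect), so that Link wins a connect sum when
   k1 + k2 > 0 with Link to move, or k1 + k2 > 1 with Knot to move.  It follows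
   that k = 0 in a P-position and k = 1 in an N-position, which settles the
   connect sum of two N-positions; the other cases follow from answering in the
   same summand, with the parity of n guaranteeing that an answer exists.     *)

Set Implicit Arguments.
Unset Strict Implicit.
Unset Printing Implicit Defensive.

(* Imported again: arc would otherwise denote the cyclic sub-path of path.v. *)
Import Defs.
Import GroupScope.

(** * Orbits of permutations and Euler's inequality *)

Section PermutationOrbits.
Variable T : finType.
Implicit Types (s t r : {perm T}) (A R : {set T}).

Lemma porbits_mul_tperm_r s x y :
  #|porbits (s * tperm x y)| + (x \notin porbit s y).*2
    = #|porbits s| + (x != y).
Proof.
rewrite -porbitsV invMg tpermV -porbitV.
by rewrite porbits_mul_tperm porbitsV.
Qed.

Lemma porbits1 : #|porbits (1 : {perm T})| = #|T|.
Proof.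
rewrite card_imset // => x y /eqP; rewrite eq_porbit_mem.
by case/porbitP=> i ->; rewrite expg1n perm1.
Qed.

Definition closed_under s A := forall x, x \in A -> s x \in A.

Lemma closed_underV s A x : closed_under s A -> s x \in A -> x \in A.
Proof.
move=> sA Asx; have Ai i : (s ^+ i) (s x) \in A.
  by elim: i => [|i IHi]; rewrite ?perm1 // expgSr permM sA.
have: x \in porbit s (s x) by rewrite porbit_sym (mem_porbit s 1).
by case/porbitP=> i ->.
Qed.

Lemma closed_underE s A x : closed_under s A -> (s x \in A) = (x \in A).
Proof. by move=> sA; apply/idP/idP=> [/closed_underV-> | /sA]. Qed.

Lemma closed_under_porbit s A x y :
  closed_under s A -> y \in porbit s x -> (y \in A) = (x \in A).
Proof.
move=> sA /porbitP[i ->]; elim: i => [|i IHi]; rewrite ?perm1 //.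
by rewrite expgSr permM closed_underE.
Qed.

Lemma closed_under_tperm s x y A :
  closed_under s A -> (x \in A) = (y \in A) -> closed_under (s * tperm x y) A.
Proof.
move=> sA Exy z Az; rewrite permM.
by case: tpermP => [E|E|_ _]; rewrite -?E ?Exy -?E ?sA // -Exy -E sA.
Qed.

(* Euler's inequality (nonnegativity of the genus) for the hypermap (s, t);
   a set R meeting every component stands for the number of components.      *)
Lemma porbits_genus s t R :
    (forall A, closed_under s A -> closed_under t A -> A != set0 ->
       A :&: R != set0) ->
  #|porbits s| + #|porbits t| + #|porbits (s * t)| <= #|T| + 2 * #|R|.
Proof.
(* Induction on the number of points moved by [t]. If [t = 1], every orbit of [s] meets [R], which
   is the inequality. *)
have [m] := ubnP #|[set x | t x != x]|.
elim: m t R => // m IHm t R; rewrite ltnS => le_m meetR.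
have [fix_t | [x]] := set_0Vmem [set x | t x != x].
  have{le_m fix_t} t1: t = 1.
    apply/permP=> x; rewrite perm1; apply/eqP/negPn.
    by move/setP/(_ x): fix_t; rewrite !inE => ->.
  rewrite {}t1 mulg1 porbits1 in meetR *.
  suff: #|porbits s| <= #|R| by lia.
  apply: leq_trans (leq_imset_card (porbit s) R).
  apply/subset_leq_card/subsetP=> _ /imsetP[x _ ->].
  have/set0Pn[y]: porbit s x :&: R != set0.
    apply: meetR => [y|y yx|]; last by apply/set0Pn; exists x; apply: porbit_id.
    - by rewrite -!eq_porbit_mem (porbit_perm s 1).
    - by rewrite perm1.
  rewrite inE -eq_porbit_mem => /andP[/eqP <- Ry]; exact: imset_f.
rewrite inE => tx_x; set y := t x in tx_x.
(* [t'] takes [x] out of its cycle, so it has one orbit more than [t], while [s * t'] and [s * t]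
   differ by one orbit in either direction. *)
pose t' := t * tperm x y.
have t'x : t' x = x by rewrite permM tpermR.
have t'E : t = t' * tperm x y by rewrite -mulgA tperm2 mulg1.
have st'E : s * t = (s * t') * tperm x y by rewrite -mulgA -t'E.
have lt_m : #|[set z | t' z != z]| < m.
  apply: leq_trans le_m; apply: proper_card.
  apply/properP; split; last by exists x; rewrite inE ?t'x ?eqxx.
  apply/subsetP=> z; rewrite !inE; apply: contra_neq => tz.
  rewrite /t' permM tz; case: tpermP => // [zx|zy].
    by rewrite /y -zx.
  have /perm_inj zx : t z = t x by rewrite tz zy.
  by rewrite zx.
(* Removing the transposition can split a component only when [x] and [y] lie in different orbits of
   [s * t']; one extra representative then suffices. *)
have [R' leR' meetR'] : exists2 R' : {set T},
    #|R'| <= #|R| + (x \notin porbit (s * t') y)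
    & forall A, closed_under s A -> closed_under t' A -> A != set0 ->
       A :&: R' != set0.
  have same A : closed_under s A -> closed_under t' A -> A != set0 ->
      (x \in A) = (y \in A) -> A :&: R != set0.
    move=> sA tA A0 Exy; apply: meetR => //.
    by rewrite t'E; apply: closed_under_tperm.
  case: (boolP (x \in _)) => [xy | _] /=.
    exists R => [|A sA tA A0]; rewrite ?addn0 //; apply: same => //.
    apply: closed_under_porbit xy => z Az; rewrite permM; exact/tA/sA.
  (* By [same], a closed set [A] that misses [R] separates [x] from [y]. If some such set [B]
     contains [x], then so do all: otherwise [A :|: B] would contain both points and miss [R]. If
     there is no such [B], all contain [y]. *)
  have [] : (exists2 z, true &
             forall A, closed_under s A -> closed_under t' A ->
             A :&: R = set0 -> A != set0 -> z \in A).
    case: (boolP [exists A : {set T}, [&& [forall z in A, s z \in A],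
       [forall z in A, t' z \in A], A :&: R == set0, x \in A & y \notin A]]).
      case/existsP=> B /and5P[/forall_inP sB /forall_inP tB /eqP BR Bx By].
      exists x => // A sA tA AR A0; apply: contraT => Ax.
      have Ay : y \in A.
        apply: contraT => Ay; have := same _ sA tA A0.
        by rewrite AR eqxx (negPf Ax) (negPf Ay); apply.
      have closedU r : closed_under r A -> {in B, forall z, r z \in B} ->
          closed_under r (A :|: B).
        by move=> rA rB z; rewrite !inE => /orP[/rA | /rB] ->; rewrite ?orbT.
      have AB0 : A :|: B != set0 by apply/set0Pn; exists x; rewrite inE Bx orbT.
      have := same _ (closedU s sA sB) (closedU t' tA tB) AB0.
      by rewrite !inE Ay Bx orbT setIUl AR BR setU0 eqxx; apply.
    rewrite negb_exists => /forallP noB; exists y => // A sA tA AR A0.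
    apply: contraT => Ay; have := noB A; rewrite AR eqxx Ay andbT /=.
    have -> : [forall z in A, s z \in A] by apply/forall_inP.
    have -> : [forall z in A, t' z \in A] by apply/forall_inP.
    move=> /= Ax; have := same _ sA tA A0.
    by rewrite AR eqxx (negPf Ax) (negPf Ay); apply.
  move=> z _ zP; exists (z |: R); first by rewrite cardsU1; case: (z \notin R); lia.
  move=> A sA tA A0; have [AR|] := eqVneq (A :&: R) set0.
    by apply/set0Pn; exists z; rewrite !inE eqxx zP.
  case/set0Pn=> u; rewrite inE => /andP[Au Ru]; apply/set0Pn.
  by exists u; rewrite !inE Au Ru orbT.
have := IHm t' R' lt_m meetR'.
have := porbits_mul_tperm_r t x y; have := porbits_mul_tperm_r (s * t') x y.
rewrite -st'E -/t' [x == y]eq_sym tx_x.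
have -> : (x \in porbit t y) by rewrite porbit_sym (mem_porbit t 1).
move: leR'; case: (x \notin porbit _ _) => /=; lia.
Qed.

(** [A] splits into pairs [{x, f x}]. The conditions on [f] are local to [A], so that [f] may be
    [arc] on a set deprived of both ends of a segment. *)
Lemma card_involution_closed (f : T -> T) A :
  (forall x, x \in A -> [/\ f x \in A, f (f x) = x & f x != x]) -> ~~ odd #|A|.
Proof.
have [m] := ubnP #|A|; elim: m A => // m IHm A; rewrite ltnS => leA fA.
have [->|[x Ax]] := set_0Vmem A; first by rewrite cards0.
have [Afx ffx fxx] := fA x Ax.
have Ax' : f x \in A :\ x by rewrite !inE fxx.
rewrite (cardsD1 x) (cardsD1 (f x)) Ax Ax' /= negbK; apply: IHm.
  by move: leA; rewrite (cardsD1 x) (cardsD1 (f x)) Ax Ax'; lia.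
move=> y; rewrite !inE => /and3P[yfx yx Ay]; have [-> ffy fyy] := fA y Ay.
rewrite ffy fyy andbT; split=> //; apply/andP; split.
  by apply: contraNneq yx => E; rewrite -ffx -E ffy.
by apply: contraNneq yfx => <-; rewrite ffy.
Qed.

(* Permutations all of whose orbits have size 2 or 4. *)
Definition even_orbits s := forall x, s x != x /\ s (s (s (s x))) = x.

(** When [even_orbits s] holds, these are the elements of the orbits of size 4; for [rot], the darts
    of the precrossings. *)
Definition quad s := [set x | s (s x) != x].

Lemma porbit_even_orbits s x :
  even_orbits s -> porbit s x =i [:: x; s x; s (s x); s (s (s x))].
Proof.
move=> es y; have [_ s4] := es x; rewrite !inE.
have inO i : iter i s x \in porbit s x by rewrite -permX mem_porbit.
apply/idP/idP.
  case/porbitP=> i ->; elim: i => [|i IHi]; rewrite ?perm1 ?eqxx //.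
  rewrite expgSr permM.
  by case/or4P: IHi => /eqP ->; rewrite ?s4 eqxx ?orbT.
by case/or4P=> /eqP ->; 
  [exact: (inO 0) | exact: (inO 1%N) | exact: (inO 2) | exact: (inO 3)].
Qed.

Lemma card_porbit_quad s x :
  even_orbits s -> #|porbit s x| = if x \in quad s then 4 else 2.
Proof.
move=> es; have [sx s4] := es x.
rewrite (eq_card (porbit_even_orbits x es)) inE; case: eqP => [s2|/eqP s2] /=.
  rewrite -[2]/(size [:: x; s x]).
  rewrite -(card_uniqP (_ : uniq [:: x; s x])); last by rewrite /= inE eq_sym sx.
  by apply: eq_card => y; rewrite !inE !s2; case: (y == x); case: (y == s x).
have s3 : s (s (s x)) != x by apply: contraNneq sx => E; rewrite -{1}E s4.
apply/card_uniqP => /=.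
by rewrite !inE !negb_or !(inj_eq perm_inj) !(eq_sym x) sx s2 s3.
Qed.

Lemma even_orbitsP s :
  (forall x, #|porbit s x| = 2 \/ #|porbit s x| = 4) -> even_orbits s.
Proof.
move=> cs x; have := iter_porbit s x; have := uniq_traject_porbit s x.
case: (cs x) => -> /=; rewrite !inE.
  by rewrite andbT eq_sym => -> ssx; rewrite !ssx.
by rewrite !negb_or => /andP[/and3P[sx _ _] _] ->; rewrite eq_sym sx.
Qed.

Lemma card_porbits_quad s :
  even_orbits s -> (4 * #|porbits s| + #|quad s| = 2 * #|T|)%N.
Proof.
(* The weight is 4 divided by the size of the orbit, so every orbit has total weight 4. *)
move=> es; pose w x := if x \in quad s then 1%N else 2.
have quadE : (\sum_x w x + #|quad s| = 2 * #|T|)%N.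
  rewrite -[#|quad s|]sum1_card [X in (_ + X)%N]big_mkcond -big_split /=.
  rewrite mulnC -sum_nat_const.
  by apply: eq_bigr => x _; rewrite /w; case: ifP.
suff : (\sum_x w x = #|porbits s| * 4)%N by lia.
rewrite (partition_big_imset (porbit s)) /= -sum_nat_const.
apply: eq_bigr => _ /imsetP[x _ ->].
have wE y : porbit s y == porbit s x -> w y = w x.
  move=> /eqP E; have := card_porbit_quad y es; rewrite E card_porbit_quad // /w.
  by case: ifP; case: ifP.
rewrite (eq_bigr (fun=> w x)) => [|y]; last exact: wE.
rewrite sum_nat_cond_const.
have -> : #|[set y | porbit s y == porbit s x]| = #|porbit s x|.
  by apply: eq_card => y; rewrite !inE eq_porbit_mem.
by rewrite card_porbit_quad // /w; case: ifP.
Qed.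

(** * Smoothing an orbit of size four *)

Section Smoothing.
Variables (s : {perm T}) (x : T).
Hypotheses (es : even_orbits s) (sx : x \in quad s).
Let s' := s * tperm x (s (s x)).

Let s'_out y : y \notin porbit s x -> s' y = s y /\ s y \notin porbit s x.
Proof.
move=> Oy; have Osy : s y \notin porbit s x.
  by rewrite porbit_sym -eq_porbit_mem eq_sym (porbit_perm s 1) eq_porbit_mem.
split=> //; rewrite permM tpermD //; apply: contraNneq Osy => <-.
  exact: porbit_id.
by have := mem_porbit s 2 x; rewrite permX.
Qed.

(** The 4-cycle of [x] splits into the 2-cycles [(x, s x)] and [(s (s x), s (s (s x)))]. *)
Let s'_in y : y \in porbit s x -> s' y != y /\ s' (s' y) = y.
Proof.
have [sx1 s4] := es x; have [sx3 _] := es (s (s x)).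
move: sx; rewrite inE => sx2.
rewrite (porbit_even_orbits x es) !inE.
have a' : s' x = s x by rewrite permM tpermD // 1?eq_sym // (inj_eq perm_inj) eq_sym.
have b' : s' (s x) = x by rewrite permM tpermR.
have d' : s' (s (s (s x))) = s (s x) by rewrite permM s4 tpermL.
have c' : s' (s (s x)) = s (s (s x)).
  rewrite permM tpermD // 1?eq_sym //.
  by apply: contraNneq sx1 => E; rewrite -{1}E s4.
by case/or4P=> /eqP ->; rewrite ?(a', b', c', d') ?(a', b', c', d') // eq_sym.
Qed.

Lemma quad_smoothing : quad s' = quad s :\: porbit s x.
Proof.
apply/setP=> y; rewrite !inE; case: (boolP (y \in _)) => [/s'_in[_ ->] | Oy] /=.
  by rewrite eqxx.
by have [-> /s'_out[-> _]] := s'_out Oy.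
Qed.

Lemma card_quad_smoothing : #|quad s| = #|quad s'| + 4.
Proof.
have <- : #|porbit s x| = 4 by rewrite card_porbit_quad ?sx.
rewrite quad_smoothing -(cardsID (porbit s x) (quad s)) addnC.
congr (_ + _); apply: eq_card => y; rewrite inE andbC.
have [Oy|//] := boolP (y \in porbit s x); rewrite /=.
have := card_porbit_quad y es; have/eqP-> : porbit s y == porbit s x.
  by rewrite eq_porbit_mem.
by rewrite card_porbit_quad // sx; case: ifP.
Qed.

Lemma even_orbits_smoothing : even_orbits s'.
Proof.
move=> y; have [/s'_in[s'y s's'y]|Oy] := boolP (y \in porbit s x).
  by rewrite !s's'y.
have [-> /s'_out[-> /s'_out[-> /s'_out[-> _]]]] := s'_out Oy; exact: es.
Qed.

End Smoothing.

End PermutationOrbits.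

(** * Checkerboard colourings and imbalance *)

Section Diagrams.
Implicit Type D : diagram.

Definition diagram_closed D (A : {set dart D}) :=
  closed_under (arc D) A /\ closed_under (rot D) A.

Lemma connectedP D :
  connected D <->
  (forall (A : {set dart D}) x y, diagram_closed A -> x \in A -> y \in A).
Proof.
split=> [/forallP cD A x y [arcA rotA] Ax|cD].
  have /connectP[p] := forallP (cD x) y.
  elim: p x Ax => [|z p IHp] x Ax /=; first by move=> _ ->.
  by case/andP=> /orP[]/eqP -> pth /IHp; apply=> //; [apply: arcA | apply: rotA].
apply/forallP=> x; apply/forallP=> y.
have := cD [set z | connect (@adjacent D) x z] x y; rewrite !inE; apply=> //.
by split=> z; rewrite !inE => /connect_trans; apply; apply: connect1;
  rewrite /adjacent /= eqxx ?orbT.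
Qed.

(** A closed set contains both or neither of [d] and [rot D (rot D d)], so it stays closed after the
    smoothing: a disconnected diagram stays disconnected. *)
Lemma connected_smooth D (d : dart D) : connected (smooth d) -> connected D.
Proof.
move=> /connectedP cD; apply/connectedP=> A x y [arcA rotA]; apply: cD; split=> //.
by apply: closed_under_tperm => //; rewrite !closed_underE.
Qed.

Definition regular D :=
  (forall x, arc D (arc D x) = x /\ arc D x != x) /\ even_orbits (rot D).

Definition ncross D := #|quad (rot D)| %/ 4.

Lemma precrossing_quad D (d : dart D) :
  even_orbits (rot D) -> precrossing d = (d \in quad (rot D)).
Proof. by move=> eD; rewrite /precrossing card_porbit_quad //; case: ifP. Qed.

Lemma even_orbits_smooth D (d : dart D) :
  even_orbits (rot D) -> precrossing d -> even_orbits (rot (smooth d)).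
Proof. by move=> eD; rewrite precrossing_quad //; apply: even_orbits_smoothing. Qed.

Lemma regular_smooth D (d : dart D) :
  regular D -> precrossing d -> regular (smooth d).
Proof. by case=> aD eD cd; split=> //; apply: even_orbits_smooth. Qed.

Lemma ncross_smooth D (d : dart D) :
  even_orbits (rot D) -> precrossing d -> ncross D = (ncross (smooth d)).+1.
Proof.
move=> eD; rewrite precrossing_quad // /ncross => cd.
by rewrite (card_quad_smoothing eD cd) divnDr // addn1.
Qed.

Lemma ncross_eq0 D :
  even_orbits (rot D) -> ncross D = 0 <-> forall d : dart D, ~~ precrossing d.
Proof.
move=> eD; split=> [n0 d|noc].
  by apply/negP=> cd; have := ncross_smooth eD cd; rewrite n0.
rewrite /ncross; suff -> : quad (rot D) = set0 by rewrite cards0.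
by apply/setP=> d; rewrite -precrossing_quad // (negPf (noc d)) inE.
Qed.

Lemma ncross_gt0 D :
  even_orbits (rot D) -> 0 < ncross D <-> exists d : dart D, precrossing d.
Proof.
move=> eD; split=> [|[d /(ncross_smooth eD) ->]] //.
case: (boolP [exists d : dart D, precrossing d]) => [/existsP // | ].
rewrite negb_exists => /forallP noc.
by move/(ncross_eq0 eD): noc => ->.
Qed.

Lemma card_dart D : regular D -> #|dart D| = (2 * #|porbits (arc D)|)%N.
Proof.
case=> aD _; have ea : even_orbits (arc D).
  by move=> x; have [ax ->] := aD x; have [-> _] := aD x.
have := card_porbits_quad ea.
have -> : quad (arc D) = set0.
  by apply/setP=> x; have [ax _] := aD x; rewrite !inE ax eqxx.
rewrite cards0; lia.
Qed.

Definition euler D :=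
  #|porbits (rot D)| + #|porbits (face D)| = #|porbits (arc D)| + 2.

Lemma connected_genus D :
  regular D -> connected D ->
  #|porbits (rot D)| + #|porbits (face D)| <= #|porbits (arc D)| + 2.
Proof.
move=> rD /connectedP cD.
have := @porbits_genus _ (arc D) (rot D) [set ext D].
rewrite cards1 -/(face D) card_dart // => genus; suff: 
   #|porbits (arc D)| + #|porbits (rot D)| + #|porbits (face D)|
    <= 2 * #|porbits (arc D)| + 2 by lia.
apply: genus => A arcA rotA /set0Pn[x Ax]; apply/set0Pn.
by exists (ext D); rewrite !inE eqxx andbT; apply: cD Ax.
Qed.

(** Counting darts gives 4V + 4n = 4E, hence E - V = n, and Euler's formula yields F = n + 2. *)
Lemma card_faces D :
  regular D -> euler D -> #|porbits (face D)| = ncross D + 2.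
Proof.
move=> rD; rewrite /euler /ncross => eu; have [_ eD] := rD.
have := card_porbits_quad eD; rewrite card_dart //.
move=> E; have -> : #|quad (rot D)|
  = ((#|porbits (arc D)| - #|porbits (rot D)|) * 4)%N by lia.
by rewrite mulnK //; lia.
Qed.

(** A smoothing raises V by one, keeps E and changes F by one. The genus inequality forbids an
    increase of F, so F drops and V + F is kept. *)
Lemma euler_smooth D (d : dart D) :
    regular D -> euler D -> precrossing d -> connected (smooth d) ->
  euler (smooth d).
Proof.
move=> rD eu cd cD'; have rD' := regular_smooth rD cd.
have := connected_genus rD' cD'; move: (eu); rewrite /euler.
have [_ eD] := rD; have [_ eD'] := rD'.
have := card_porbits_quad eD; have := card_porbits_quad eD'.
have qd : d \in quad (rot D) by rewrite -precrossing_quad.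
rewrite (card_quad_smoothing eD qd) /= => E' E.
have -> : face (smooth d) = face D * tperm d (rot D (rot D d)).
  by rewrite /face /= mulgA.
have := porbits_mul_tperm_r (face D) d (rot D (rot D d)).
by move: qd; rewrite inE eq_sym => ->; case: (d \notin _) => /=; lia.
Qed.

Definition alternating D (col : dart D -> bool) :=
  forall x, col (arc D x) = ~~ col x /\ col (rot D x) = ~~ col x.

(** * Double covers of permutations *)

Section DoubleCover.
Variables (T : finType).

Definition cover_fun (b : bool) (s : {perm T}) (x : T * bool) :=
  (s x.1, b (+) x.2).

Lemma cover_fun_inj b s : injective (cover_fun b s).
Proof. by move=> [x u] [y v] [/perm_inj -> /addbI ->]. Qed.

Definition cover b s : {perm T * bool} := perm (@cover_fun_inj b s).

Lemma coverE b s x u : cover b s (x, u) = (s x, b (+) u).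
Proof. by rewrite permE. Qed.

Lemma even_orbits_cover b s : even_orbits s -> even_orbits (cover b s).
Proof.
move=> es [x u]; have [sx s4] := es x; rewrite !coverE s4 !addbA !addbb.
by split; [apply: contraNneq sx => [[->]]|].
Qed.

Lemma card_quad_cover b s : #|quad (cover b s)| = (#|quad s| * 2)%N.
Proof.
rewrite -card_bool -[#|{: bool}|]cardsT -cardsX; apply: eq_card => [[x u]].
rewrite !inE !coverE addbA addbb /= andbT -pair_eqE /= eqxx andbT.
by [].
Qed.

(** All orbits of [s] have even size, so one turn around an orbit returns to the starting sheet even
    when [b] is true: each orbit has two lifts. *)
Lemma card_porbits_cover b s :
  even_orbits s -> #|porbits (cover b s)| = (2 * #|porbits s|)%N.
Proof.
move=> es; have := card_porbits_quad es.
have := card_porbits_quad (even_orbits_cover b es).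
rewrite card_quad_cover card_prod card_bool; lia.
Qed.

(** Faces may have any size, but [cover false] preserves the sheets, so an orbit has one copy on
    each. *)
Lemma leq_porbits_cover s : 2 * #|porbits s| <= #|porbits (cover false s)|.
Proof.
pose lift (p : {set T} * bool) := setX p.1 [set p.2].
have lift_inj : {in setX (porbits s) [set: bool] &, injective lift}.
  move=> [A u] [B v]; rewrite !inE /= !andbT => /imsetP[x _ ->] /imsetP[y _ ->].
  move=> /setP E; have := E (x, u); rewrite !inE porbit_id eqxx /=.
  by move=> /esym/andP[xy /eqP <-]; congr (_, _); apply/eqP; rewrite eq_porbit_mem.
rewrite mulnC -card_bool -cardsT -cardsX -(card_in_imset lift_inj).
apply/subset_leq_card/subsetP=> _ /imsetP[[A u] + ->].
rewrite !inE andbT => /imsetP[x _ /= ->].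
apply/imsetP; exists (x, u) => //; apply/setP=> [[y v]]; rewrite !inE /=.
have powE i : (cover false s ^+ i) (x, u) = ((s ^+ i) x, u).
  by elim: i => [|i IHi]; rewrite ?perm1 // !expgSr !permM IHi coverE.
apply/andP/porbitP => [[/porbitP[i ->] /eqP ->]|[i]]; first by exists i.
by rewrite powE => -[-> ->]; rewrite mem_porbit.
Qed.

End DoubleCover.

(* If no alternating colouring existed, the orientation double cover of D,
   with arc and rot switching the sheets, would be a connected map of Euler
   characteristic 4.                                                         *)
Lemma alternating_exists D :
  regular D -> connected D -> euler D -> exists col, @alternating D col.
Proof.
move=> rD /connectedP cD eu; have [aD eD] := rD.
pose a2 := cover true (arc D); pose r2 := cover true (rot D).
have a2r2 : a2 * r2 = cover false (face D).
  by apply/permP=> [[x u]]; rewrite permM !coverE permM addbA.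
have ea : even_orbits (arc D).
  by move=> x; have [ax ->] := aD x; have [-> _] := aD x.
pose x0 := (ext D, false).
case: (boolP [exists A : {set dart D * bool},
   [&& [forall z in A, a2 z \in A], [forall z in A, r2 z \in A], A != set0
     & x0 \notin A]]); last first.
  (* Here [x0] meets every component of the cover, and the genus inequality gives 2E + 2V + 2F <= 4E
     + 2, against V + F = E + 2. *)
  rewrite negb_exists => /forallP noA.
  have := @porbits_genus _ a2 r2 [set x0].
  rewrite a2r2 cards1 card_prod card_bool (card_porbits_cover _ ea).
  rewrite (card_porbits_cover _ eD) card_dart //.
  have := leq_porbits_cover (face D); move: eu; rewrite /euler => eu leF genus.
  suff : forall A, closed_under a2 A -> closed_under r2 A -> A != set0 ->
     A :&: [set x0] != set0 by move/genus; lia.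
  move=> A aA rA A0; have := noA A; rewrite A0.
  have -> : [forall z in A, a2 z \in A] by apply/forall_inP.
  have -> : [forall z in A, r2 z \in A] by apply/forall_inP.
  by rewrite /= negbK => Ax0; apply/set0Pn; exists x0; rewrite !inE Ax0 eqxx.
case/existsP=> A /and4P[/forall_inP aA /forall_inP rA /set0Pn[[z w] Az] Ax0].
have aE x u : (arc D x, u) \in A = ((x, ~~ u) \in A).
  have <- := @closed_underE _ a2 A (x, ~~ u) aA.
  by rewrite coverE /= negbK.
have rE x u : (rot D x, u) \in A = ((x, ~~ u) \in A).
  have <- := @closed_underE _ r2 A (x, ~~ u) rA.
  by rewrite coverE /= negbK.
(* Exactly one lift of every dart lies in [A]: the darts with some lift in [A] form a nonempty
   closed set, and those with both form a closed set that omits [ext D]. Membership of the lift on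
   sheet [true] is then the colouring. *)
have some x : ((x, true) \in A) || ((x, false) \in A).
  have := cD [set x | ((x, true) \in A) || ((x, false) \in A)] z x.
  rewrite !inE; apply; last by case: w Az => ->; rewrite ?orbT.
  by split=> y; rewrite !inE ?aE ?rE orbC.
have notboth x : ~~ (((x, true) \in A) && ((x, false) \in A)).
  apply/negP=> Ax.
  have := cD [set x | ((x, true) \in A) && ((x, false) \in A)] x (ext D).
  rewrite !inE (negPf Ax0) andbF; move=> absurd.
  suff : false by []; apply: absurd Ax.
  by split=> y; rewrite !inE ?aE ?rE andbC.
exists (fun x => (x, true) \in A) => x; rewrite aE rE /=.
by move: (some x) (notboth x); case: (_ \in _); case: (_ \in _).
Qed.

(* The faces of the colour b of their darts: black regions for one value of b,
   white regions for the other.                                              *)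
Definition faces D (col : dart D -> bool) (b : bool) :=
  porbit (face D) @: [set x | col x == b].

Lemma col_face_porbit D (col : dart D -> bool) x y :
  alternating col -> y \in porbit (face D) x -> col y = col x.
Proof.
move=> alt /porbitP[i ->]; elim: i => [|i <-]; rewrite ?perm1 // expgSr !permM.
have [_ ->] := alt (arc D ((face D ^+ i) x)).
by have [-> _] := alt ((face D ^+ i) x); rewrite negbK.
Qed.

Lemma card_faces_col D (col : dart D -> bool) :
  alternating col ->
  #|porbits (face D)| = #|faces col true| + #|faces col false|.
Proof.
move=> alt; rewrite -cardsUI.
have -> : faces col true :&: faces col false = set0.
  apply/setP=> A; rewrite !inE; apply/negP => /andP[/imsetP[x + ->] /imsetP[y]].
  rewrite !inE => /eqP cx /eqP cy /eqP; rewrite eq_porbit_mem.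
  by move/(col_face_porbit alt); rewrite cx cy.
rewrite cards0 addn0 -imsetU; apply: eq_card => A.
by apply/imsetP/imsetP=> -[x _ ->]; exists x; rewrite // !inE; case: (col x).
Qed.

Lemma faces_gt0 D (col : dart D -> bool) b :
  alternating col -> 0 < #|faces col b|.
Proof.
move=> alt; have [cx _] := alt (ext D).
pose y := if col (ext D) == b then ext D else arc D (ext D).
apply/card_gt0P; exists (porbit (face D) y); apply/imset_f; rewrite inE {}/y.
by case: ifP => //; rewrite cx; case: (col _) b => [] [].
Qed.

Lemma alternating_smooth D (d : dart D) (col : dart D -> bool) :
  alternating col -> @alternating (smooth d) col.
Proof.
move=> alt x; have [ax rx] := alt x; split=> //=; rewrite permM.
have rr y : col (rot D (rot D y)) = col y.
  by have [_ ->] := alt (rot D y); have [_ ->] := alt y; rewrite negbK.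
by case: tpermP => [E|E|_ _] //; rewrite -rx E ?rr.
Qed.

(** The transposition moves only [d] and [rot D (rot D d)], which have the same colour; boundaries
    of regions of the other colour never meet them. *)
Lemma faces_smooth D (d : dart D) (col : dart D -> bool) :
  alternating col -> @faces (smooth d) col (~~ col d) = faces col (~~ col d).
Proof.
move=> alt; apply: eq_in_imset => x; rewrite inE => /eqP cx.
have rr y : col (rot D (rot D y)) = col y.
  by have [_ ->] := alt (rot D y); have [_ ->] := alt y; rewrite negbK.
have powE i : (face (smooth d) ^+ i) x = (face D ^+ i) x.
  elim: i => [|i IHi]; rewrite ?perm1 // !expgSr !permM IHi /=.
  have : col ((face D ^+ i.+1) x) = ~~ col d.
    by rewrite -cx; apply: col_face_porbit alt _; apply: mem_porbit.
  rewrite expgSr !permM => cy; rewrite tpermD //.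
    by apply: contra_eqN cy => /eqP <-; case: (col d).
  by apply: contra_eqN cy => /eqP <-; rewrite rr; case: (col d).
by apply/setP=> y; apply/porbitP/porbitP=> -[i ->]; exists i; rewrite powE.
Qed.

Definition checkered D (col : dart D -> bool) :=
  [/\ regular D, connected D, euler D & alternating col].

Lemma checkered_smooth D (d : dart D) (col : dart D -> bool) :
    checkered col -> precrossing d -> connected (smooth d) ->
  @checkered (smooth d) col
  /\ #|faces col (col d)| = (#|@faces (smooth d) col (col d)|).+1.
Proof.
move=> [rD cD eu alt] cd cD'; have rD' := regular_smooth rD cd.
have eu' := euler_smooth rD eu cd cD'; have alt' := alternating_smooth (d := d) alt.
split=> //; have := card_faces rD eu; have := card_faces rD' eu'.
have [_ eD] := rD; rewrite (ncross_smooth eD cd).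
rewrite (card_faces_col alt) (card_faces_col alt').
have := faces_smooth d alt; case: (col d) => /= ->; lia.
Qed.

(* The connected final diagrams need #|faces col true| - 1 smoothings of one
   kind and #|faces col false| - 1 of the other; k measures the discrepancy. *)
Definition imbalanced D k :=
  exists2 col, @checkered D col
    & #|faces col true| - #|faces col false|
      + (#|faces col false| - #|faces col true|) = k.

Lemma shadow_imbalanced D : shadow D -> exists k, imbalanced D k.
Proof.
case=> aD rD cD eu; have regD : regular D.
  split=> [x|]; last exact: even_orbitsP.
  by have [-> /eqP] := aD x.
have [col alt] := alternating_exists regD cD eu.
by eexists; exists col.
Qed.

Lemma imbalanced_regular D k : imbalanced D k -> regular D.
Proof. by case=> col []. Qed.

Lemma imbalanced_connected D k : imbalanced D k -> connected D.
Proof. by case=> col []. Qed.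

Lemma imbalanced_smooth D k (d : dart D) :
    imbalanced D k -> precrossing d -> connected (smooth d) ->
  exists2 k', imbalanced (smooth d) k' & k' = k.+1 \/ k = k'.+1.
Proof.
move=> [col ck kE] cd cD'; have [ck' F] := checkered_smooth ck cd cD'.
eexists; first by exists col; first exact: ck'.
have [_ _ _ alt] := ck.
have := faces_smooth d alt; move: F; rewrite -kE.
by case: (col d) => /= F ->; lia.
Qed.

(** Each precrossing has darts of both colours, [d] and [rot D d], so a region can be removed from a
    colour [b] that has no more regions than the other. *)
Lemma imbalanced_step D k :
    imbalanced D k -> 0 < ncross D ->
  exists2 d : dart D, precrossing d
    & connected (smooth d) -> imbalanced (smooth d) k.+1.
Proof.
move=> [col ck kE]; have [rD _ _ alt] := ck; have [_ eD] := rD.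
case/ncross_gt0=> // d cd.
pose b := #|faces col true| <= #|faces col false|.
have [e ce colE] : exists2 e : dart D, precrossing e & col e = b.
  have [cde|cde] := eqVneq (col d) b; first by exists d.
  exists (rot D d); last by have [_ ->] := alt d; case: (col d) b cde => [] [].
  move: cd; rewrite !precrossing_quad // !inE; apply: contra_neq => E.
  exact: perm_inj E.
exists e => // cD'; have [ck' F] := checkered_smooth ck ce cD'.
exists col => //; move: F (faces_smooth e alt); rewrite colE -kE.
rewrite /b; case: leqP => + /= + ->;
  move: #|faces col _| #|faces col _| #|@faces (smooth e) col _|; lia.
Qed.

(** The two colour counts are positive and add up to n + 2. *)
Lemma imbalanced_parity D k :
  imbalanced D k -> odd k = odd (ncross D) /\ k <= ncross D.
Proof.
move=> [col [rD cD eu alt] kE]; have := card_faces rD eu.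
rewrite (card_faces_col alt).
have := faces_gt0 true alt; have := faces_gt0 false alt; lia.
Qed.

End Diagrams.

(** * Connect sums *)

Section Sums.

Lemma tperm_conjE (T : finType) (s : {perm T}) (u v x : T) :
  (s ^ tperm u v) x = tperm u v (s (tperm u v x)).
Proof. by rewrite -{1}[x](tpermK u v) permJ. Qed.

Lemma sum_permE (S T : finType) (s : {perm S}) (t : {perm T}) (z : S + T) :
  sum_perm s t z = match z with inl x => inl (s x) | inr y => inr (t y) end.
Proof. by rewrite permE. Qed.

Section ConnectSum.
Variables (D1 D2 : diagram) (d1 : dart D1) (d2 : dart D2).
Hypotheses (r1 : regular D1) (r2 : regular D2).
Let D := connect_sum d1 d2.

Lemma arc_sumE (z : dart D) :
  arc D z = match z with
    | inl x => if x == d1 then inr (arc D2 d2)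
               else if x == arc D1 d1 then inr d2 else inl (arc D1 x)
    | inr y => if y == d2 then inl (arc D1 d1)
               else if y == arc D2 d2 then inl d1 else inr (arc D2 y)
    end.
Proof.
have inlE (x y : dart D1) : (@inl _ (dart D2) x == inl y) = (x == y) by [].
have inrE (x y : dart D2) : (@inr (dart D1) _ x == inr y) = (x == y) by [].
have [[a1 _] [a2 _]] := (r1, r2).
have [a11 n1] := a1 d1; have [a22 n2] := a2 d2.
rewrite /= tperm_conjE; case: z => x.
  have [->|x1] := eqVneq x d1.
    by rewrite tpermL sum_permE tpermD // inrE eq_sym.
  rewrite [tperm _ _ (inl x)]tpermD ?[_ == inl x]eq_sym // sum_permE.
  have [->|xa] := eqVneq x (arc D1 d1); first by rewrite a11 tpermL.
  rewrite tpermD // inlE; apply: contraNneq xa => E.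
  by have [<- _] := a1 x; rewrite -E.
have [->|x1] := eqVneq x d2.
  by rewrite tpermR sum_permE tpermD // inlE eq_sym.
rewrite [tperm _ _ (inr x)]tpermD ?[_ == inr x]eq_sym // sum_permE.
have [->|xa] := eqVneq x (arc D2 d2); first by rewrite a22 tpermR.
rewrite tpermD // inrE; apply: contraNneq xa => E.
by have [<- _] := a2 x; rewrite -E.
Qed.

Lemma rot_sumE (z : dart D) :
  rot D z = match z with inl x => inl (rot D1 x) | inr y => inr (rot D2 y) end.
Proof. exact: sum_permE. Qed.

Lemma even_orbits_sum : even_orbits (rot D).
Proof.
have [[_ e1] [_ e2]] := (r1, r2).
case=> x; rewrite !rot_sumE.
  by have [n1 ->] := e1 x.
by have [n2 ->] := e2 x.
Qed.

Lemma precrossing_sum (z : dart D) :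
  precrossing z = match z with inl x => precrossing x | inr y => precrossing y end.
Proof.
have [[_ e1] [_ e2]] := (r1, r2).
rewrite precrossing_quad; last exact: even_orbits_sum.
by case: z => x; rewrite precrossing_quad // !inE !rot_sumE.
Qed.

Lemma smooth_suml (x : dart D1) :
  @smooth D (inl x) = @connect_sum (smooth x) D2 d1 d2.
Proof.
rewrite /smooth /connect_sum /=; congr Diagram.
apply/permP=> z; rewrite permM !sum_permE.
case: z => y; rewrite ?permM; last by rewrite tpermD.
by case: (tpermP x) => [->|->|/eqP y1 /eqP y2];
  rewrite ?tpermL ?tpermR // tpermD // eq_sym.
Qed.

Lemma smooth_sumr (x : dart D2) :
  @smooth D (inr x) = @connect_sum D1 (smooth x) d1 d2.
Proof.
rewrite /smooth /connect_sum /=; congr Diagram.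
apply/permP=> z; rewrite permM !sum_permE.
case: z => y; rewrite ?permM; first by rewrite tpermD.
by case: (tpermP x) => [->|->|/eqP y1 /eqP y2];
  rewrite ?tpermL ?tpermR // tpermD // eq_sym.
Qed.

Lemma connected_suml : connected D -> connected D1.
Proof.
have [[a1 _] [a2 _]] := (r1, r2).
move=> /connectedP cD; apply/connectedP=> A x y [arcA rotA] Ax.
(* All of [D2] is put on the side of [d1]. This is consistent because [A] contains [arc D1 d1]
   exactly when it contains [d1]. *)
pose B : {set dart D} :=
  [set z | match z with inl x => x \in A | inr _ => d1 \in A end].
have := cD B (inl x) (inl y); rewrite !inE; apply=> //.
split=> -[] z; rewrite !inE ?arc_sumE ?rot_sumE //=.
- case: ifP => [/eqP -> //|_]; case: ifP => [/eqP ->|_]; last exact: arcA.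
  by rewrite closed_underE.
- by do 2?case: ifP => // _; rewrite closed_underE.
- exact: rotA.
Qed.

Lemma connected_sumr : connected D -> connected D2.
Proof.
have [[a1 _] [a2 _]] := (r1, r2).
move=> /connectedP cD; apply/connectedP=> A x y [arcA rotA] Ax.
pose B : {set dart D} :=
  [set z | match z with inl _ => d2 \in A | inr x => x \in A end].
have := cD B (inr x) (inr y); rewrite !inE; apply=> //.
split=> -[] z; rewrite !inE ?arc_sumE ?rot_sumE //=.
- by do 2?case: ifP => // _; rewrite closed_underE.
- case: ifP => [/eqP -> //|_]; case: ifP => [/eqP ->|_]; last exact: arcA.
  by rewrite closed_underE.
- exact: rotA.
Qed.

End ConnectSum.

(* In a final diagram the points of the curve pair the darts, as the segments
   do: cutting one segment does not separate its two ends.                   *)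
Lemma final_cut_segment D (d : dart D) (A : {set dart D}) :
    regular D -> ncross D = 0 -> closed_under (rot D) A ->
    (forall x, x \in A -> x != d -> x != arc D d -> arc D x \in A) ->
  closed_under (arc D) A.
Proof.
move=> [aD eD] n0 rotA arcA.
have noc := (ncross_eq0 eD).1 n0.
have evA : ~~ odd #|A|.
  apply: (@card_involution_closed _ (rot D)) => x Ax; split; first exact: rotA.
    by apply/eqP; have := noc x; rewrite precrossing_quad // inE negbK.
  by case: (eD x).
have [aad nad] := aD d.
have evA' : ~~ odd #|A :\ d :\ arc D d|.
  apply: (@card_involution_closed _ (arc D)) => x.
  rewrite !inE => /and3P[xad xd Ax]; have [aax nax] := aD x.
  rewrite arcA // andbT (inj_eq perm_inj) xd; split=> //.
  by apply: contraNneq xad => <-; rewrite aax.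
(* [A] has even size before and after its intersection with the two ends of the segment is removed,
   so it contains both ends or neither. *)
have same : (d \in A) = (arc D d \in A).
  move: evA evA'; rewrite (cardsD1 d) (cardsD1 (arc D d) (A :\ d)) !inE nad /=.
  rewrite !oddD => odA /negPf odA'; move: odA; rewrite odA'.
  by do 2!case: (_ \in A).
move=> x Ax; have [xd|xd] := eqVneq x d; first by rewrite xd -same -xd.
have [xad|xad] := eqVneq x (arc D d); last exact: arcA.
by rewrite xad aad same -xad.
Qed.

Lemma connected_sum_final D1 D2 (d1 : dart D1) (d2 : dart D2) :
    regular D1 -> regular D2 -> ncross D1 = 0 -> ncross D2 = 0 ->
    connected D1 -> connected D2 ->
  connected (connect_sum d1 d2).
Proof.
move=> r1 r2 n1 n2 /connectedP c1 /connectedP c2.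
have [[a1 _] [a2 _]] := (r1, r2).
have [a11 n11] := a1 d1; have [a22 n22] := a2 d2.
apply/connectedP=> A x y [arcA rotA] Ax.
have arcE z : (arc _ z \in A) = (z \in A) := closed_underE z arcA.
pose A1 := [set z | inl z \in A]; pose A2 := [set z | inr z \in A].
have cl1 : diagram_closed A1.
  have rotA1 : closed_under (rot D1) A1.
    by move=> z; rewrite !inE => /rotA; rewrite rot_sumE.
  split=> //; apply: (final_cut_segment (d := d1)) => // z.
  rewrite !inE => /arcA; rewrite arc_sumE // => + /negPf zd /negPf zad.
  by rewrite zd zad.
have cl2 : diagram_closed A2.
  have rotA2 : closed_under (rot D2) A2.
    by move=> z; rewrite !inE => /rotA; rewrite rot_sumE.
  split=> //; apply: (final_cut_segment (d := d2)) => // z.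
  rewrite !inE => /arcA; rewrite arc_sumE // => + /negPf zd /negPf zad.
  by rewrite zd zad.
have cross : (d1 \in A1) = (arc D2 d2 \in A2).
  by rewrite !inE -arcE arc_sumE // eqxx.
have all1 u v : inl u \in A -> inl v \in A.
  by move=> Au; have := c1 A1 u v cl1; rewrite !inE; apply.
have all2 u v : inr u \in A -> inr v \in A.
  by move=> Au; have := c2 A2 u v cl2; rewrite !inE; apply.
rewrite !inE in cross.
case: x y Ax => [x|x] [y|y] Ax; [exact: all1 Ax| | |exact: all2 Ax].
- by apply: (all2 (arc D2 d2)); rewrite -cross; apply: all1 Ax.
- by apply: (all1 d1); rewrite cross; apply: all2 Ax.
Qed.

(** The two orders of summands give different dart types. Allowing both makes the relation
    symmetric, so strategies can be described for one summand and transferred by [is_sumC]. *)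
Definition is_sum (D1 D2 D : diagram) :=
  (exists d1 d2, D = @connect_sum D1 D2 d1 d2) \/
  (exists d2 d1, D = @connect_sum D2 D1 d2 d1).

Lemma is_sumC D1 D2 D : is_sum D1 D2 D -> is_sum D2 D1 D.
Proof. by case=> [[d1 [d2 ->]]|[d2 [d1 ->]]]; [right|left]; do 2!eexists. Qed.

Section IsSum.
Variables D1 D2 D : diagram.
Hypotheses (r1 : regular D1) (r2 : regular D2) (sD : is_sum D1 D2 D).

Lemma is_sum_even_orbits : even_orbits (rot D).
Proof. by case: sD => [[d1 [d2 ->]]|[d2 [d1 ->]]]; apply: even_orbits_sum. Qed.

Lemma is_sum_movel (x : dart D1) :
  precrossing x ->
  exists2 d : dart D, precrossing d & is_sum (smooth x) D2 (smooth d).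
Proof.
move=> cx; case: sD => [[d1 [d2 ->]]|[d2 [d1 ->]]].
  by exists (inl x); rewrite ?precrossing_sum // smooth_suml; left; do 2!eexists.
by exists (inr x); rewrite ?precrossing_sum // smooth_sumr; right; do 2!eexists.
Qed.

Lemma is_sum_move (d : dart D) : precrossing d ->
  (exists2 x : dart D1, precrossing x & is_sum (smooth x) D2 (smooth d)) \/
  (exists2 x : dart D2, precrossing x & is_sum D1 (smooth x) (smooth d)).
Proof.
case: sD d => [[d1 [d2 ->]]|[d2 [d1 ->]]] [] x; rewrite precrossing_sum // => cx.
- by left; exists x => //; rewrite smooth_suml; left; do 2!eexists.
- by right; exists x => //; rewrite smooth_sumr; left; do 2!eexists.
- by right; exists x => //; rewrite smooth_suml; right; do 2!eexists.
- by left; exists x => //; rewrite smooth_sumr; right; do 2!eexists.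
Qed.

Lemma is_sum_connectedl : connected D -> connected D1.
Proof.
case: sD => [[d1 [d2 ->]]|[d2 [d1 ->]]]; first exact: connected_suml.
exact: connected_sumr.
Qed.

Lemma is_sum_connected_final :
  ncross D1 = 0 -> ncross D2 = 0 -> connected D1 -> connected D2 -> connected D.
Proof.
move=> n1 n2 c1 c2.
by case: sD => [[d1 [d2 ->]]|[d2 [d1 ->]]]; apply: connected_sum_final.
Qed.

Lemma is_sum_ncross_eq0 :
  ncross D1 = 0 -> ncross D2 = 0 -> forall d : dart D, ~~ precrossing d.
Proof.
have [[_ e1] [_ e2]] := (r1, r2).
move=> /(ncross_eq0 e1) n1 /(ncross_eq0 e2) n2 d; apply/negP=> /is_sum_move[] [x].
  by rewrite (negPf (n1 x)).
by rewrite (negPf (n2 x)).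
Qed.

End IsSum.

Lemma is_sum_mover D1 D2 D (x : dart D2) :
    regular D1 -> regular D2 -> is_sum D1 D2 D -> precrossing x ->
  exists2 d : dart D, precrossing d & is_sum D1 (smooth x) (smooth d).
Proof.
move=> r1 r2 /is_sumC sD /(is_sum_movel r2 r1 sD)[d cd /is_sumC sD'].
by exists d.
Qed.

End Sums.

(** * Strategies *)

Section Game.
Implicit Types (p q : player) (D : diagram).

Lemma can_win_inv p q D : can_win p q D ->
  [\/ (forall d : dart D, ~~ precrossing d) /\ winner D = p,
      q = p /\ (exists2 d : dart D, precrossing d
                  & can_win p (opponent p) (smooth d))
    | [/\ q = opponent p, exists d : dart D, precrossing d
        & forall d : dart D, precrossing d -> can_win p p (smooth d)]].
Proof.
by case=> [{}q {}D noc w|{}D d cd w|{}D ex w];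
  [constructor 1 | constructor 2; split=> //; exists d | constructor 3].
Qed.

Lemma opponent_neq p : p <> opponent p.
Proof. by case: p. Qed.

Lemma winner_Knot D : winner D = Knot <-> connected D.
Proof. by rewrite /winner; case: connected. Qed.

Lemma winner_Link D : winner D = Link <-> ~~ connected D.
Proof. by rewrite /winner; case: connected. Qed.

Lemma can_win_final p q D :
  even_orbits (rot D) -> ncross D = 0 -> can_win p q D -> winner D = p.
Proof.
move=> eD /(ncross_eq0 eD) noc.
by case/can_win_inv=> [[]|[_ [d]]|[_ [d]]] //; rewrite (negPf (noc d)).
Qed.

Lemma can_win_own p D :
    even_orbits (rot D) -> 0 < ncross D -> can_win p p D ->
  exists2 d : dart D, precrossing d & can_win p (opponent p) (smooth d).
Proof.
move=> eD /(ncross_gt0 eD)[d cd] /can_win_inv[[noc _]|[]//|[/opponent_neq]//].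
by rewrite (negPf (noc d)) in cd.
Qed.

Lemma can_win_opponent p D (d : dart D) :
  can_win p (opponent p) D -> precrossing d -> can_win p p (smooth d).
Proof.
move=> /can_win_inv[[noc _] cd|[/esym/opponent_neq]//|[_ _]]; last exact.
by rewrite (negPf (noc d)) in cd.
Qed.

Lemma can_win_Knot_connected q D : can_win Knot q D -> connected D.
Proof.
elim=> {q D}[q D noc /winner_Knot //|D d _ _ /connected_smooth //|D [d cd] _ IH].
exact: connected_smooth (IH d cd).
Qed.

(** [can_win] looks at connectedness only in final diagrams; this recovers Link's win at the moment
    of disconnection. *)
Lemma Link_wins_disconnected q D :
  even_orbits (rot D) -> ~~ connected D -> can_win Link q D.
Proof.
have [m] := ubnP (ncross D).
elim: m q D => // m IHm q D; rewrite ltnS => le_m eD cD.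
have next p (d : dart D) : precrossing d -> can_win Link p (smooth d).
  move=> cd; apply: IHm; first by rewrite -(ncross_smooth eD).
    exact: even_orbits_smooth.
  by apply: contra cD; apply: connected_smooth.
have [/(ncross_eq0 eD) n0|/(ncross_gt0 eD)[d cd]] := posnP (ncross D).
  by apply: WinOver => //; apply/winner_Link.
case: q; last exact: WinOwnMove cd (next _ _ cd).
by apply: (@WinOpponentMove Link) => [|e ce]; [exists d | apply: next].
Qed.

Lemma can_win_Link_gt0 q D :
  even_orbits (rot D) -> connected D -> can_win Link q D -> 0 < ncross D.
Proof.
move=> eD cD w; rewrite lt0n; apply/negP=> /eqP n0.
by have := can_win_final eD n0 w; rewrite winner_Link cD.
Qed.

(* Knot can afford an imbalance of at most one, and only when moving first:
   Link can always increase the imbalance, whereas Knot removes at most one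
   unit per move.                                                            *)
Lemma can_win_Knot_imbalance q D k :
    can_win Knot q D -> imbalanced D k ->
  match q with Link => k = 0 | Knot => 0 < ncross D -> k = 1%N end.
Proof.
move=> w; elim: w k => {q D}[q D noc _|D d cd w IH|D [d cd] w IH] k iD;
  have [aD eD] := imbalanced_regular iD; have [par le] := imbalanced_parity iD.
- by have n0 := (ncross_eq0 eD).2 noc; case: q; lia.
- have [k' iD' kk] := imbalanced_smooth iD cd (can_win_Knot_connected w).
  by have /= := IH _ iD'; lia.
(* With k > 0, Link moves to k + 1 >= 2. A precrossing remains since the imbalance is at most n, so
   the induction hypothesis would give k + 1 = 1. *)
- have [-> //|k_gt0] := posnP k.
  have [|e ce iD'] := imbalanced_step iD; first lia.
  have {}iD' := iD' (can_win_Knot_connected (w e ce)).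
  have [_ le'] := imbalanced_parity iD'.
  by have /= := IH e ce _ iD'; lia.
Qed.

(** * Strategies on a connect sum *)

Lemma is_sum_Link_wins_disconnected q D1 D2 D :
    regular D1 -> regular D2 -> is_sum D1 D2 D -> ~~ connected D1 ->
  can_win Link q D.
Proof.
move=> r1 r2 sD cD1; apply: Link_wins_disconnected.
  exact: is_sum_even_orbits sD.
by apply: contra cD1; apply: is_sum_connectedl sD.
Qed.

Lemma is_sum_ncross_gt0 D1 D2 D :
    regular D1 -> regular D2 -> is_sum D1 D2 D ->
    0 < ncross D1 + ncross D2 -> exists d : dart D, precrossing d.
Proof.
move=> r1 r2 sD; have [[_ e1] [_ e2]] := (r1, r2).
rewrite addn_gt0 => /orP[/(ncross_gt0 e1)|/(ncross_gt0 e2)] [x cx].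
  by have [d cd _] := is_sum_movel r1 r2 sD cx; exists d.
by have [d cd _] := is_sum_mover r1 r2 sD cx; exists d.
Qed.

Lemma is_sum_own_move p D1 D2 D (x : dart D1) :
    regular D1 -> regular D2 -> is_sum D1 D2 D -> precrossing x ->
    (forall E, is_sum (smooth x) D2 E -> can_win p (opponent p) E) ->
  can_win p p D.
Proof.
move=> r1 r2 sD cx w; have [d cd /w] := is_sum_movel r1 r2 sD cx.
exact: WinOwnMove cd.
Qed.

Lemma is_sum_reply p D1 D2 D :
    regular D1 -> regular D2 -> is_sum D1 D2 D -> 0 < ncross D1 + ncross D2 ->
    (forall (x : dart D1) E,
       precrossing x -> is_sum (smooth x) D2 E -> can_win p p E) ->
    (forall (x : dart D2) E,
       precrossing x -> is_sum D1 (smooth x) E -> can_win p p E) ->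
  can_win p (opponent p) D.
Proof.
move=> r1 r2 sD n_gt0 wl wr; apply: WinOpponentMove => [|d cd].
  exact: is_sum_ncross_gt0 sD n_gt0.
by have [[x cx /(wl x _ cx)]|[x cx /(wr x _ cx)]] := is_sum_move r1 r2 sD cd.
Qed.

Lemma is_sum_Link_wins_imbalanced q D1 D2 D k1 k2 :
    imbalanced D1 k1 -> imbalanced D2 k2 -> is_sum D1 D2 D ->
    match q with Link => 0 | Knot => 1%N end < k1 + k2 ->
  can_win Link q D.
Proof.
have [m] := ubnP (ncross D1 + ncross D2).
elim: m q D1 D2 D k1 k2 => // m IHm q D1 D2 D k1 k2; rewrite ltnS => le_m.
move=> i1 i2 sD k_gt.
(* Link to move raises the positive [j1], leaving a total of at least 2 for Knot. *)
have own E1 E2 E j1 j2 : ncross E1 + ncross E2 <= m -> imbalanced E1 j1 ->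
    imbalanced E2 j2 -> is_sum E1 E2 E -> 0 < j1 -> can_win Link Link E.
  move=> le_m' jE1 jE2 sE j_gt0.
  have [s1 s2] := (imbalanced_regular jE1, imbalanced_regular jE2).
  have [_ le] := imbalanced_parity jE1.
  have [|x cx jx] := imbalanced_step jE1; first exact: leq_trans le.
  apply: (is_sum_own_move s1 s2 sE cx) => E' sE'.
  have [cx'|cx'] := boolP (connected (smooth x)); last first.
    exact: (is_sum_Link_wins_disconnected _ (regular_smooth s1 cx) s2 sE' cx').
  apply: (IHm Knot _ _ _ _ _ _ (jx cx') jE2 sE'); last lia.
  by move: le_m'; rewrite (ncross_smooth s1.2 cx).
(* Knot lowers a total of at least 2 by at most one, so it is still positive when Link moves. *)
have reply E1 E2 j1 j2 (x : dart E1) E : ncross E1 + ncross E2 <= m ->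
    imbalanced E1 j1 -> imbalanced E2 j2 -> 1 < j1 + j2 ->
    precrossing x -> is_sum (smooth x) E2 E -> can_win Link Link E.
  move=> le_m' jE1 jE2 j_gt1 cx sE.
  have [s1 s2] := (imbalanced_regular jE1, imbalanced_regular jE2).
  have [cx'|cx'] := boolP (connected (smooth x)); last first.
    exact: (is_sum_Link_wins_disconnected _ (regular_smooth s1 cx) s2 sE cx').
  have [j jx jE] := imbalanced_smooth jE1 cx cx'.
  apply: (IHm Link _ _ _ _ _ _ jx jE2 sE); last lia.
  by move: le_m'; rewrite (ncross_smooth s1.2 cx).
have [r1 r2] := (imbalanced_regular i1, imbalanced_regular i2).
case: q k_gt => k_gt.
  have [_ le1] := imbalanced_parity i1; have [_ le2] := imbalanced_parity i2.
  apply: (@is_sum_reply Link _ _ _ r1 r2 sD) => [|x E|x E cx /is_sumC]; first lia.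
    exact: reply i1 i2 k_gt.
  by apply: reply i2 i1 _ cx; rewrite addnC.
have [k1_gt0|k1_0] := posnP k1; last exact: own i1 i2 sD _.
by apply: own i2 i1 (is_sumC sD) _; lia.
Qed.

Lemma is_sum_second_wins p D1 D2 D :
    regular D1 -> regular D2 -> is_sum D1 D2 D ->
    ~~ odd (ncross D1) -> ~~ odd (ncross D2) ->
    can_win p (opponent p) D1 -> can_win p (opponent p) D2 ->
  can_win p (opponent p) D.
Proof.
have [m] := ubnP (ncross D1 + ncross D2).
elim: m D1 D2 D => // m IHm D1 D2 D; rewrite ltnS => le_m r1 r2 sD o1 o2 w1 w2.
have [[_ e1] [_ e2]] := (r1, r2).
have [n0|n_gt0] := posnP (ncross D1 + ncross D2).
  have [n1 n2] : ncross D1 = 0 /\ ncross D2 = 0 by lia.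
  apply: WinOver; first exact: is_sum_ncross_eq0 sD n1 n2.
  have := can_win_final e1 n1 w1; have := can_win_final e2 n2 w2.
  case: (p) => [/winner_Knot c2 /winner_Knot c1|_ /winner_Link c1].
    by apply/winner_Knot; apply: is_sum_connected_final sD n1 n2 c1 c2.
  by apply/winner_Link; apply: contra c1; apply: is_sum_connectedl sD.
have reply E1 E2 (x : dart E1) E : ncross E1 + ncross E2 <= m ->
    regular E1 -> regular E2 -> ~~ odd (ncross E1) -> ~~ odd (ncross E2) ->
    can_win p (opponent p) E1 -> can_win p (opponent p) E2 ->
    precrossing x -> is_sum (smooth x) E2 E -> can_win p p E.
  move=> le_m' s1 s2 odd1 odd2 v1 v2 cx sE.
  have nx := ncross_smooth s1.2 cx; have sx := regular_smooth s1 cx.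
  (* The summand had an even number of precrossings, so an odd number remains and the answer of [p]
     can be made there. *)
  have [|y cy vy] := can_win_own sx.2 _ (can_win_opponent v1 cx); first lia.
  apply: (is_sum_own_move sx s2 sE cy) => E' sE'.
  have ny := ncross_smooth sx.2 cy.
  apply: (IHm _ _ _ _ (regular_smooth sx cy) s2 sE' _ odd2 vy v2); lia.
apply: (is_sum_reply r1 r2 sD n_gt0) => x E cx; first exact: reply cx.
by move/is_sumC; apply: reply cx; rewrite // addnC.
Qed.

(** Link answers by the winning strategy in [D1] and arbitrarily in [D2], where evenness leaves a
    precrossing for the answer. In [D1] an answer can be lacking only after disconnection, when Link
    has already won. *)
Lemma is_sum_Link_wins_second D1 D2 D :
    regular D1 -> regular D2 -> is_sum D1 D2 D -> ~~ odd (ncross D2) ->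
    can_win Link Knot D1 ->
  can_win Link Knot D.
Proof.
have [m] := ubnP (ncross D1 + ncross D2).
elim: m D1 D2 D => // m IHm D1 D2 D; rewrite ltnS => le_m r1 r2 sD o2 w1.
have [c1|c1] := boolP (connected D1); last first.
  exact: is_sum_Link_wins_disconnected sD c1.
have n1_gt0 := can_win_Link_gt0 r1.2 c1 w1.
apply: (@is_sum_reply Link _ _ _ r1 r2 sD) => [|x E cx sE|x E cx sE]; first lia.
  have nx := ncross_smooth r1.2 cx; have rx := regular_smooth r1 cx.
  have wx := can_win_opponent (p := Link) w1 cx.
  have [cx'|cx'] := boolP (connected (smooth x)); last first.
    exact: is_sum_Link_wins_disconnected sE cx'.
  have [y cy wy] := can_win_own rx.2 (can_win_Link_gt0 rx.2 cx' wx) wx.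
  apply: (is_sum_own_move rx r2 sE cy) => E' sE'.
  have ny := ncross_smooth rx.2 cy.
  by apply: (IHm _ _ _ _ (regular_smooth rx cy) r2 sE' o2 wy); lia.
have nx := ncross_smooth r2.2 cx; have rx := regular_smooth r2 cx.
have /(ncross_gt0 rx.2)[y cy] : 0 < ncross (smooth x) by lia.
apply: (is_sum_own_move rx r1 (is_sumC sE) cy) => E' /is_sumC sE'.
have ny := ncross_smooth rx.2 cy.
by apply: (IHm _ _ _ _ r1 (regular_smooth rx cy) sE' _ w1); lia.
Qed.

Lemma is_sum_Link_wins_first D1 D2 D k1 k2 :
    imbalanced D1 k1 -> imbalanced D2 k2 -> is_sum D1 D2 D ->
    can_win Link Link D1 ->
  can_win Link Link D.
Proof.
move=> i1 i2 sD w1.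
have [r1 r2] := (imbalanced_regular i1, imbalanced_regular i2).
(* If [D2] is odd, then k2 is odd, hence positive, and imbalance wins. Otherwise Link opens in [D1]
   and becomes the second player. *)
have [o2|o2] := boolP (odd (ncross D2)).
  have [par _] := imbalanced_parity i2.
  by apply: (is_sum_Link_wins_imbalanced i1 i2 sD); lia.
have n1_gt0 := can_win_Link_gt0 r1.2 (imbalanced_connected i1) w1.
have [x cx wx] := can_win_own r1.2 n1_gt0 w1.
apply: (is_sum_own_move r1 r2 sD cx) => E sE.
exact: (is_sum_Link_wins_second (regular_smooth r1 cx) r2 sE o2 wx).
Qed.

Lemma is_sum_L_position D1 D2 D k1 k2 :
    imbalanced D1 k1 -> imbalanced D2 k2 -> is_sum D1 D2 D ->
  L_position D1 -> L_position D.
Proof.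
move=> i1 i2 sD w1 [|]; last exact: is_sum_Link_wins_first i1 i2 sD (w1 Link).
have [r1 r2] := (imbalanced_regular i1, imbalanced_regular i2).
(* With [D2] odd, a Knot move in [D1] leaves k2 > 0 with Link to move; after a Knot move in [D2],
   Link uses its win as first player in [D1]. *)
have [o2|] := boolP (odd (ncross D2)); last first.
  by move=> o2; apply: (is_sum_Link_wins_second r1 r2 sD o2 (w1 Knot)).
have [par _] := imbalanced_parity i2.
apply: (@is_sum_reply Link _ _ _ r1 r2 sD) => [|x E cx sE|x E cx sE]; first lia.
  have [cx'|cx'] := boolP (connected (smooth x)); last first.
    exact: (is_sum_Link_wins_disconnected _ (regular_smooth r1 cx) r2 sE cx').
  have [k ix _] := imbalanced_smooth i1 cx cx'.
  by apply: (is_sum_Link_wins_imbalanced ix i2 sE); lia.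
have [cx'|cx'] := boolP (connected (smooth x)); last first.
  have rx := regular_smooth r2 cx.
  exact: (is_sum_Link_wins_disconnected _ rx r1 (is_sumC sE) cx').
have [k ix _] := imbalanced_smooth i2 cx cx'.
exact: is_sum_Link_wins_first i1 ix sE (w1 Link).
Qed.

Lemma P_position_imbalance D k :
  imbalanced D k -> P_position D -> k = 0.
Proof. by move=> iD w; apply: (can_win_Knot_imbalance (q := Link) (w Knot) iD). Qed.

Lemma N_position_imbalance D k :
  imbalanced D k -> N_position D -> k = 1%N.
Proof.
move=> iD w; have [_ eD] := imbalanced_regular iD.
(* Link, too, wins moving first although [D] is connected, so [D] has a precrossing. *)
have n_gt0 := can_win_Link_gt0 eD (imbalanced_connected iD) (w Link).
exact: (can_win_Knot_imbalance (q := Knot) (w Knot) iD n_gt0).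
Qed.

End Game.

Theorem proposition13 (D1 D2 : diagram) (d1 : dart D1) (d2 : dart D2)
  (shD1 : shadow D1) (shD2 : shadow D2)
  (extd1 : exterior d1) (extd2 : exterior d2) :
  [/\ P_position D1 -> P_position D2 -> P_position (connect_sum d1 d2),
      P_position D1 -> N_position D2 -> N_position (connect_sum d1 d2),
      N_position D1 -> N_position D2 -> L_position (connect_sum d1 d2)
    & L_position D1 \/ L_position D2 -> L_position (connect_sum d1 d2)].
Proof.
have [k1 i1] := shadow_imbalanced shD1; have [k2 i2] := shadow_imbalanced shD2.
have [r1 r2] := (imbalanced_regular i1, imbalanced_regular i2).
have [par1 _] := imbalanced_parity i1; have [par2 _] := imbalanced_parity i2.
have sD : is_sum D1 D2 (connect_sum d1 d2) by left; exists d1, d2.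
split.
- move=> P1 P2 p; have k10 := P_position_imbalance i1 P1.
  have k20 := P_position_imbalance i2 P2.
  by apply: (is_sum_second_wins r1 r2 sD _ _ (P1 p) (P2 p)); lia.
- move=> P1 N2 p; have k10 := P_position_imbalance i1 P1.
  have k21 := N_position_imbalance i2 N2.
  (* After a winning first move in [D2], both summands have even precrossing counts and are won by
     [p] as second player. *)
  have [|x cx wx] := can_win_own r2.2 _ (N2 p); first lia.
  have nx := ncross_smooth r2.2 cx.
  apply: (is_sum_own_move r2 r1 (is_sumC sD) cx) => E /is_sumC sE.
  have rx := regular_smooth r2 cx.
  by apply: (is_sum_second_wins r1 rx sE _ _ (P1 p) wx); lia.
- move=> N1 N2 q; have k11 := N_position_imbalance i1 N1.
  have k21 := N_position_imbalance i2 N2.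
  by apply: (is_sum_Link_wins_imbalanced i1 i2 sD); case: q; lia.
- case=> [|L2]; first exact: is_sum_L_position i1 i2 sD.
  exact: is_sum_L_position i2 i1 (is_sumC sD) L2.
Qed.
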